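(* Let $k$ be an algebraically closed field of arbitrary characteristic, let $N\ge 2$, and let $s\ge 1$ be an integer with $s\leq (N+1)/2$. Let $I\subset k[\mathbb{P}^N]=k[x_0,\ldots,x_N]$ be the ideal of $s$ general lines in $\mathbb{P}^N$. Then $$\rho(I)=\rho'_a(I)=\rho_a(I)=\max\left(1,\ 2\,\frac{s-1}{s}\right).$$ Moreover, if $2s<N+1$, then $\gamma(I)=1$, while if $2s=N+1$, then $\gamma(I)=\dfrac{N+1}{N-1}$.
   Context: The ideal of a closed subscheme of $\mathbb{P}^N$ is its saturated homogeneous ideal in $k[x_0,\ldots,x_N]$; for a union of lines $L_1,\dots,L_s$ (reduced) it is $I=\bigcap_{i} I(L_i)$. A statement about ''$s$ general lines'' means that it holds for all $s$-tuples of lines in some nonempty Zariski open subset of the $s$-fold product of the Grassmannian of lines in $\mathbb{P}^N$. For a homogeneous ideal $(0)\ne I\subsetneq R=k[x_0,\ldots,x_N]$, the $m$-th symbolic power is $I^{(m)}=\bigcap_{P\in\operatorname{Ass}(I)}(I^mR_P\cap R)$; for the ideal of disjoint lines $L_1,\dots,L_s$ this is $\bigcap_i I(L_i)^m$. Let $\alpha(J)$ denote the least degree of a nonzero element of a nonzero homogeneous ideal $J$, and let $\gamma(I)=\lim_{m\to\infty}\alpha(I^{(m)})/m$ (the limit exists). Resurgences (with $m,r$ ranging over positive integers): $\rho(I)=\sup\{m/r : I^{(m)}\not\subseteq I^r\}$; $\rho_a(I)=\sup\{m/r : I^{(mt)}\not\subseteq I^{rt}\text{ for all } t\gg0\}$;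 $\rho'_a(I)=\limsup_{t\to\infty}\rho(I,t)$, where $\rho(I,t)=\sup\{m/r : I^{(m)}\not\subseteq I^{r},\ m\geq t,\ r\geq t\}$. *)

(* Defs.v *)
From HB Require Import structures.
From mathcomp Require Import all_boot all_order all_algebra.
From mathcomp Require Import ring_quotient fraction.
From mathcomp Require Import all_classical all_reals.
From mathcomp Require Import ereal topology normedtype sequences.
(* The notations of mpoly clash with those of MathComp-Analysis. *)
From mathcomp Require Import -(notations) mpoly.

Set Implicit Arguments.
Unset Strict Implicit.
Unset Printing Implicit Defensive.

Import Order.TTheory GRing.Theory Num.Theory.
Import numFieldNormedType.Exports.

Local Open Scope classical_set_scope.
Local Open Scope ring_scope.

Section Ideals.
Variable A : idomainType.
Implicit Types (G I J P : set A).

Definition ideal_span G : set A :=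
  [set f | exists (n : nat) (c g : 'I_n -> A),
     (forall i, G (g i)) /\ f = \sum_(i < n) c i * g i].

Definition ideal_pow I (r : nat) : set A :=
  ideal_span [set f | exists g : 'I_r -> A,
                (forall i, I (g i)) /\ f = \prod_(i < r) g i].

(* [idealr_closed] includes properness. *)
Definition prime_ideal P : Prop :=
  idealr_closed (mem P) /\ prime_idealr_closed (mem P).

(* Ass(I) is the set of associated primes of the module A/I, that is, the
   prime ideals of the form (I : f). *)
Definition Ass I : set (set A) :=
  [set P | prime_ideal P /\ exists f : A, P = [set a | I (a * f)]].

(* The extension J A_P of J to the localization A_P at a prime P, with A_P
   viewed inside the fraction field of the domain A. *)
Definition loc_ext J P : set {fraction A} :=
  [set x | exists a b : A, [/\ J a, ~ P b & x = tofrac a / tofrac b]].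

Definition symbolic_power I (m : nat) : set A :=
  \bigcap_(P in Ass I) (@tofrac A @^-1` loc_ext (ideal_pow I m) P).

Variable R : realType.

Definition resurgence I : \bar R :=
  ereal_sup [set x | exists m r : nat, [/\ (0 < m)%N, (0 < r)%N,
    ~ symbolic_power I m `<=` ideal_pow I r & x = (m%:R / r%:R)%:E]].

Definition asymptotic_resurgence I : \bar R :=
  ereal_sup [set x | exists m r : nat, [/\ (0 < m)%N, (0 < r)%N,
    \forall t \near \oo,
      ~ symbolic_power I (m * t) `<=` ideal_pow I (r * t)
    & x = (m%:R / r%:R)%:E]].

Definition resurgence_from I (t : nat) : \bar R :=
  ereal_sup [set x | exists m r : nat,
    [/\ (0 < m)%N /\ (0 < r)%N, (t <= m)%N /\ (t <= r)%N,
    ~ symbolic_power I m `<=` ideal_pow I r & x = (m%:R / r%:R)%:E]].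

Definition asymptotic_resurgence' I : \bar R := limn_esup (resurgence_from I).

End Ideals.

Section Waldschmidt.
Variables (k : fieldType) (n : nat).
Implicit Types (I J : set (mpoly n k)).

(* [msize f] is the degree of [f] plus one when [f != 0]. *)
Definition is_least_degree J (d : nat) : Prop :=
  (exists f, [/\ J f, f != 0 & (msize f).-1 = d]) /\
  (forall f, J f -> f != 0 -> (d <= (msize f).-1)%N).

(* The default value 0 is taken only when [J] has no nonzero element. *)
Definition alpha J : nat := xget 0%N [set d | is_least_degree J d].

Variable R : realType.

Definition waldschmidt_seq I (m : nat) : R :=
  (alpha (symbolic_power I m))%:R / m%:R.

Definition waldschmidt I : R := lim (waldschmidt_seq I @ \oo).

End Waldschmidt.

Section Lines.
Variables (k : fieldType) (N s : nat).

(* A line of P^N is a 2-dimensional subspace of k^(N+1). *)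
Definition line : Type := {V : {vspace 'rV[k]_N.+1} | \dim V == 2%N}.

Definition pt_coord (v : 'rV[k]_N.+1) : 'I_N.+1 -> k := fun i => v 0 i.

Definition line_ideal (L : line) : set (mpoly N.+1 k) :=
  ideal_span [set f | (exists d : nat, f \is ishomog1 d mdeg) /\
    forall v : 'rV[k]_N.+1, v \in val L -> v != 0 -> meval (pt_coord v) f = 0].

Definition lines_ideal (L : 'I_s -> line) : set (mpoly N.+1 k) :=
  \bigcap_(l in [set: 'I_s]) line_ideal (L l).

(* Pluecker coordinates, computed on a chosen basis of the subspace: another
   basis multiplies all of them by the same nonzero scalar.  All pairs (i, j)
   are kept, not only those with i < j. *)
Definition plucker (L : line) (i j : 'I_N.+1) : k :=
  let u := (vbasis (val L))`_0 in let v := (vbasis (val L))`_1 in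
  u 0 i * v 0 j - u 0 j * v 0 i.

(* Index set of the Pluecker coordinates p^(l)_(i,j) of an s-tuple of lines;
   polynomials in these have their variables numbered by [enum_rank]. *)
Definition plucker_index : finType :=
  ('I_s * ('I_N.+1 * 'I_N.+1))%type.

Definition plucker_poly : Type := mpoly #|plucker_index| k.

Definition multihomogeneous (F : plucker_poly) : Prop :=
  forall l : 'I_s, exists d : nat, forall m, m \in msupp F ->
    (\sum_(e < #|plucker_index| | (enum_val e).1 == l) m e)%N = d.

Definition plucker_eval (F : plucker_poly) (L : 'I_s -> line) : k :=
  meval (fun e => let p := enum_val e in plucker (L p.1) p.2.1 p.2.2) F.

(* Zariski topology on the s-fold product of the Grassmannian of lines,
   embedded in a product of s projective spaces by Pluecker coordinates:
   the closed sets are the common zero sets of multihomogeneous polynomials. *)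
Definition zariski_closed (Z : set ('I_s -> line)) : Prop :=
  exists S : set plucker_poly, (forall F, S F -> multihomogeneous F) /\
    Z = [set L | forall F, S F -> plucker_eval F L = 0].

Definition zariski_open (U : set ('I_s -> line)) : Prop :=
  zariski_closed (~` U).

Definition for_general_lines (Q : ('I_s -> line) -> Prop) : Prop :=
  exists U : set ('I_s -> line), [/\ zariski_open U, U !=set0 & U `<=` Q].

End Lines.

(* Main.v *)
(** Independent lines are the images of coordinate lines under a linear change
    of variables, where the line [l] is spanned by the basis vectors [2l] and
    [2l+1].  All the ideals become monomial: writing [b_l] for the degree of a
    monomial in the two variables of block [l] and [e] for its degree in the
    variables outside all blocks, the monomial lies in [I^(m)] iff
    [e + sum_(j != l) b_j >= m] for all [l], and in [I^r] iff moreover it lies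
    in [I^(r)] and [2e + sum_j b_j >= 2r], because the generators of [I] are the
    outer variables and the products of two variables of distinct blocks.
    Summing the [s] inequalities bounds [m/r] and the degree from one side;
    the monomials with all [b_l] equal give the other side. *)
Require Import Defs.
From HB Require Import structures.
From mathcomp Require Import all_boot all_order all_algebra.
From mathcomp Require Import perm ring_quotient fraction.
From mathcomp Require Import all_classical all_reals.
From mathcomp Require Import ereal topology normedtype sequences.
From mathcomp Require Import -(notations) mpoly.
From mathcomp Require Import ring zify.
Import Order.TTheory GRing.Theory Num.Theory.
Import numFieldNormedType.Exports.
Local Open Scope classical_set_scope.
Local Open Scope ring_scope.

Set Implicit Arguments.
Unset Strict Implicit.
Unset Printing Implicit Defensive.

(** * Powers and symbolic powers of ideals *)

Section IdealTheory.
Context {A : idomainType}.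
Implicit Types (I J P : set A).

(** Symbolic powers are defined through associated primes and localizations, so before any monomial
    appears they must be identified with intersections of powers of line ideals. This requires the
    associated primes of [I] and the primariness of the powers of a prime generated by variables.
    Independence of the lines is used twice: it gives the change of variables, and for each line a
    linear form vanishing on all the other lines but not on it. It is an open condition because the
    change of variables is a matrix built from Pluecker coordinates, with multihomogeneous
    determinant; the lines spanned by consecutive basis vectors show that the open set is nonempty.
    For the resurgences, write the expected value as [p / q]. Noncontainment of the [m]-th symbolic
    power in the [r]-th power forces [m * q < p * r]; conversely this inequality gives
    noncontainment only for large multiples [(m * t, r * t)]. Multiples keep the ratio, so this weak
    converse already determines all three resurgences. *)

Lemma span_add (G : set A) f g :
  ideal_span G f -> ideal_span G g -> ideal_span G (f + g).
Proof.
move=> [n [c [u [Gu ->]]]] [n' [c' [u' [Gu' ->]]]].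
exists (n + n')%N, (fun i => match fintype.split i with inl j => c j | inr j => c' j end),
  (fun i => match fintype.split i with inl j => u j | inr j => u' j end); split.
  by move=> i; case: (fintype.split i).
rewrite big_split_ord /=; congr (_ + _); apply: eq_bigr => i _.
  by case: splitP => [j /= /ord_inj <-//|j /= e]; have := ltn_ord i; lia.
by case: splitP => [j /= e|j /= /addnI/ord_inj <-//]; have := ltn_ord j; lia.
Qed.

Lemma span_mul (G : set A) a f : ideal_span G f -> ideal_span G (a * f).
Proof.
move=> [n [c [u [Gu ->]]]]; exists n, (fun i => a * c i), u; split => //.
by rewrite mulr_sumr; apply: eq_bigr => i _; rewrite mulrA.
Qed.

Lemma span_gen (G : set A) f : G f -> ideal_span G f.
Proof.
by move=> Gf; exists 1%N, (fun=> 1), (fun=> f); split => //; rewrite big_ord1 mul1r.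
Qed.

Lemma span0 (G : set A) : ideal_span G 0.
Proof.
exists 0%N, (fun=> 0), (fun=> 0); split; first by case.
by rewrite big_ord0.
Qed.

Lemma span_sum (G : set A) (T : eqType) (r : seq T) (F : T -> A) :
  (forall i, i \in r -> ideal_span G (F i)) -> ideal_span G (\sum_(i <- r) F i).
Proof.
move=> GF; rewrite big_seq.
by elim/big_ind: _ => //; [exact: span0|exact: span_add].
Qed.

Lemma span_min (G J : set A) : J 0 -> (forall f g, J f -> J g -> J (f + g)) ->
  (forall a f, J f -> J (a * f)) -> G `<=` J -> ideal_span G `<=` J.
Proof.
move=> J0 JD JM GJ f [n [c [u [Gu ->]]]].
by elim/big_ind: _ => // i _; apply/JM/GJ.
Qed.

Lemma pow_le I J r : I `<=` J -> ideal_pow I r `<=` ideal_pow J r.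
Proof.
move=> IJ; apply: span_min; [exact: span0|exact: span_add|exact: span_mul|].
move=> f [g [Ig ->]]; apply: span_gen; exists g; split => // i; exact/IJ.
Qed.

Lemma pow0 I f : ideal_pow I 0 f.
Proof.
rewrite -(mulr1 f); apply/span_mul/span_gen; exists (fun=> 0).
by split; [case|rewrite big_ord0].
Qed.

Lemma powS I r a b : I a -> ideal_pow I r b -> ideal_pow I r.+1 (a * b).
Proof.
move=> Ia; move: b.
apply: (span_min (J := [set b | ideal_pow I r.+1 (a * b)])) => /=.
- by rewrite mulr0; exact: span0.
- by move=> f g; rewrite mulrDr; exact: span_add.
- by move=> c f; rewrite mulrCA; exact: span_mul.
move=> f [g [Ig ->]]; apply: span_gen.
exists (fun i => if unlift ord0 i is Some j then g j else a); split.
  by move=> i; case: unliftP.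
rewrite big_ord_recl unlift_none; congr (_ * _).
by apply: eq_bigr => i _; rewrite liftK.
Qed.

Lemma prime_idealP P : prime_ideal P <->
  [/\ P 0, ~ P 1, (forall f g, P f -> P g -> P (f + g)),
      (forall a f, P f -> P (a * f)) & (forall f g, P (f * g) -> P f \/ P g)].
Proof.
split.
  move=> [[P0 P1 PD] Pp]; split; first by rewrite inE in P0.
  - by move=> P1'; move: P1; rewrite notin_setE.
  - move=> f g Pf Pg; have := PD 1 f g; rewrite !inE mul1r; exact.
  - move=> a f Pf; have := PD a f 0; rewrite !inE addr0; apply => //.
    by rewrite inE in P0.
  - move=> f g fg; have := Pp f g; rewrite !inE => /(_ fg)/orP[].
      by rewrite inE; left.
    by rewrite inE; right.
move=> [P0 P1 PD PM Pp]; split; first split.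
- by rewrite inE.
- by rewrite notin_setE.
- by move=> a f g; rewrite !inE => Pf Pg; apply/PD/Pg/PM.
move=> f g; rewrite inE => /Pp[] h; apply/orP; [left|right]; by rewrite inE.
Qed.

(** Clearing denominators replaces localization by multiplication by an element outside [P]; as [P]
    contains 0, such an element is nonzero. *)
Lemma loc_ext_tofrac J P f : P 0 ->
  (forall a g, J g -> J (a * g)) ->
  loc_ext J P (tofrac f) <-> exists2 b, ~ P b & J (b * f).
Proof.
move=> P0 JM; split.
  move=> [a [b [Ja Pb e]]]; exists b => //; suff -> : b * f = a by [].
  apply/eqP; rewrite -tofrac_eq tofracM e mulrC divfK//.
  by rewrite tofrac_eq0; apply/eqP => b0; apply: Pb; rewrite b0.
move=> [b Pb Jbf]; exists (b * f), b; split => //.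
rewrite tofracM mulrC mulKf//.
by rewrite tofrac_eq0; apply/eqP => b0; apply: Pb; rewrite b0.
Qed.

(** * Associated primes and symbolic powers of an intersection of primes *)

Section Intersection.
Variables (n : nat) (P : 'I_n -> set A) (x : 'I_n -> A).
Hypotheses (Pprime : forall i, prime_ideal (P i)) (xP : forall i, ~ P i (x i))
  (xQ : forall i j, j != i -> P j (x i)).

Let I := \bigcap_(i in [set: 'I_n]) P i.

(** The element [x i] lies in every prime except [P i], so [(I : x i) = P i]. Conversely let
    [(I : f)] be prime. If [f] avoided both [P i] and [P j], the product [x i * x j], which is in
    [I], would be in [(I : f)] while neither factor is. So [f] avoids a single [P i], and
    [(I : f) = P i]. *)
Lemma Ass_bigcap : Ass I = range P.
Proof.
have PM i a f : P i f -> P i (a * f).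
  by have /prime_idealP[_ _ _ + _] := Pprime i; apply.
have PMr i a f : P i f -> P i (f * a) by rewrite mulrC; exact: PM.
have PP i a f : P i (a * f) -> P i a \/ P i f.
  by have /prime_idealP[_ _ _ _] := Pprime i; apply.
apply/seteqP; split => Q /=; last first.
  move=> [i _ <-]; split => //; exists (x i); apply/seteqP; split => a /=.
    by move=> Pa j _; have [->|/xQ] := eqVneq j i; [exact: PMr|exact: PM].
  by move=> /(_ i Logic.I)/PP[] // /xP.
move=> [Qprime [f Qe]]; have /prime_idealP[_ Q1 _ _ QP] := Qprime.
have [i fi] : exists i, ~ P i f.
  apply: contrapT => h; apply: Q1; rewrite Qe /= mul1r => i _.
  by apply: contrapT => fi; apply: h; exists i.
have xQi j : ~ P j f -> ~ Q (x j).
  by move=> fj; rewrite Qe /= => /(_ j Logic.I)/PP[] // /xP.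
have fP j : j != i -> P j f.
  move=> ji; apply: contrapT => fj.
  have : Q (x i * x j).
    rewrite Qe => l _; have [->|/xQ ?] := eqVneq l i.
      by apply/PMr/PM/xQ; rewrite eq_sym.
    exact/PMr/PMr.
  by move=> /QP[]; exact: xQi.
exists i => //; apply/seteqP; split => a.
  rewrite Qe /= => Pa j _; have [->|/fP] := eqVneq j i; [exact: PMr|exact: PM].
by rewrite Qe /= => /(_ i Logic.I)/PP[].
Qed.

(** The hypothesis says that the powers of [P i] are primary, which cancels denominators. For the
    other inclusion the denominator [x j ^+ m] works: it supplies one [x j] to each of the [m]
    factors from [P j], moving that factor into [I]. *)
Lemma symbolic_power_bigcap (m : nat) :
  (forall i f b, ~ P i b -> ideal_pow (P i) m (b * f) -> ideal_pow (P i) m f) ->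
  symbolic_power I m = \bigcap_(i in [set: 'I_n]) ideal_pow (P i) m.
Proof.
move=> primary; rewrite /symbolic_power Ass_bigcap.
have P0 i : P i 0 by have /prime_idealP[] := Pprime i.
apply/seteqP; split => f h i /=.
  move=> _; have /loc_ext_tofrac : loc_ext (ideal_pow I m) (P i) (tofrac f).
    by apply: h; exists i.
  move=> /(_ (P0 i) (@span_mul _))[b Pb Ibf].
  by apply: primary Pb _; apply: pow_le Ibf => g; exact.
move=> [j _ <-]; apply/loc_ext_tofrac; [exact: P0|exact: span_mul|].
have /prime_idealP[_ P1 _ PM PP] := Pprime j.
exists (x j ^+ m).
  by elim: m {primary h} => [//|m IH]; rewrite exprS => /PP[] // /xP.
move: (h j Logic.I) => {h}; move: f.
apply: (span_min (J := [set f | ideal_pow I m (x j ^+ m * f)])) => /=.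
- by rewrite mulr0; exact: span0.
- by move=> f g; rewrite mulrDr; exact: span_add.
- by move=> c f; rewrite mulrCA; exact: span_mul.
move=> f [g [Pg ->]]; apply: span_gen; exists (fun i => x j * g i); split.
  move=> i' l _; have [->|/xQ] := eqVneq l j; first exact: PM.
  by have /prime_idealP[_ _ _ PM' _] := Pprime l; rewrite mulrC; exact: PM'.
by rewrite prodrMl card_ord.
Qed.

End Intersection.
End IdealTheory.

Lemma pow_preim (A B : idomainType) (phi : {rmorphism A -> B})
    (psi : {rmorphism B -> A}) (J : set B) r : cancel phi psi -> cancel psi phi ->
  ideal_pow (phi @^-1` J) r = phi @^-1` ideal_pow J r.
Proof.
move=> phiK psiK; apply/seteqP; split=> [|f /=].
  apply: span_min => /=.
  - by rewrite rmorph0; exact: span0.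
  - by move=> f g; rewrite rmorphD; exact: span_add.
  - by move=> c f; rewrite rmorphM; exact: span_mul.
  move=> f [g [Jg ->]]; rewrite /= rmorph_prod.
  by apply: span_gen; exists (phi \o g).
move=> [n [c [u [Gu e]]]].
exists n, (psi \o c), (psi \o u); split; last first.
  by rewrite -[f]phiK e rmorph_sum; apply: eq_bigr => i _; rewrite rmorphM.
move=> i; have [g [Jg ge]] := Gu i; exists (psi \o g); split.
  by move=> j /=; rewrite psiK.
by rewrite /= ge rmorph_prod.
Qed.

Lemma prime_ideal_preim (A B : idomainType) (phi : {rmorphism A -> B}) (P : set B) :
  prime_ideal P -> prime_ideal (phi @^-1` P).
Proof.
move=> /prime_idealP[P0 P1 PD PM PP].
apply/prime_idealP; split; rewrite /= ?rmorph0 ?rmorph1//.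
- by move=> f g; rewrite rmorphD; exact: PD.
- by move=> a f; rewrite rmorphM; exact: PM.
- by move=> f g; rewrite rmorphM; exact: PP.
Qed.

(** Multiplication by a polynomial with nonzero constant term preserves the order of vanishing at
    0. *)
Lemma low_coef_eq0 (A : idomainType) (q p : {poly A}) r : q`_0 != 0 ->
  (forall j, (j < r)%N -> (q * p)`_j = 0) -> forall j, (j < r)%N -> p`_j = 0.
Proof.
move=> q0 qp0 j; elim/ltn_ind: j => j IH jr; have := qp0 j jr.
rewrite coefM big_ord_recl subn0 [X in _ + X]big1 ?addr0.
  by move/eqP; rewrite mulf_eq0 (negbTE q0) => /eqP.
move=> i _; rewrite IH ?mulr0//; rewrite lift0; first have := ltn_ord i; lia.
Qed.

(** * Monomial ideals *)

(** A predicate also serves as a weight, through the coercion of booleans to 0 and 1; the weight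
    then counts the variables satisfying it. *)
Definition wdeg n (w : 'I_n -> nat) (m : multinom n) : nat :=
  (\sum_i w i * m i)%N.

(** [K] is an arbitrary set of exponents, so that the level set of a weight gives the homogeneous
    polynomials of that weight. *)
Definition monomial_ideal (k : fieldType) n (K : multinom n -> Prop) :
  set (mpoly n k) := [set f | forall m, m \in msupp f -> K m].
Arguments monomial_ideal : clear implicits.

Section Monomials.
Variables (k : fieldType) (n : nat).
Implicit Types (m u v : multinom n) (w : 'I_n -> nat) (f g : mpoly n k).
Local Notation monom m := (@mpolyX n k m).
Local Notation MI := (monomial_ideal k n).

Lemma wdegD w u v : wdeg w (mnm_add u v) = (wdeg w u + wdeg w v)%N.
Proof.
by rewrite /wdeg -big_split; apply: eq_bigr => i _ /=; rewrite mnmDE mulnDr.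
Qed.

Lemma wdeg0 w : wdeg w mnm0 = 0%N.
Proof. by rewrite /wdeg big1// => i _; rewrite mnm0E muln0. Qed.

Lemma wdeg1 w i : wdeg w (mnm1 i) = w i.
Proof.
rewrite /wdeg (bigD1 i)//= mnm1E eqxx muln1 big1 ?addn0// => j ji.
by rewrite mnm1E eq_sym (negbTE ji) muln0.
Qed.

Lemma mdeg_wdeg m : mdeg m = wdeg (fun=> 1%N) m.
Proof. by rewrite mdegE; apply: eq_bigr => i _; rewrite mul1n. Qed.

Lemma mnm_add_sub1 m i : (0 < m i)%N -> exists v, m = mnm_add (mnm1 i) v.
Proof.
move=> mi; exists (mnm_sub m (mnm1 i)); apply/mnmP => j.
by rewrite mnmDE mnmBE mnm1E; case: eqP => [<-|_] /=; lia.
Qed.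

Lemma msupp_monom m u : (u \in msupp (monom m)) = (u == m).
Proof. by rewrite msuppX inE. Qed.

Lemma monomial_ideal_monom (K : multinom n -> Prop) m : MI K (monom m) <-> K m.
Proof.
split; first by apply; rewrite msupp_monom.
by move=> Km u; rewrite msupp_monom => /eqP ->.
Qed.

Lemma monomial_ideal0 (K : multinom n -> Prop) : MI K 0.
Proof. by move=> m; rewrite mcoeff_msupp mcoeff0 eqxx. Qed.

Lemma monomial_idealD (K : multinom n -> Prop) f g :
  MI K f -> MI K g -> MI K (f + g).
Proof. by move=> Kf Kg m /msuppD_le; rewrite mem_cat => /orP[/Kf|/Kg]. Qed.

Lemma msuppM_mem f g m : m \in msupp (f * g) -> exists u v,
  [/\ u \in msupp f, v \in msupp g & m = mnm_add u v].
Proof. by move=> /msuppM_le/allpairsP[[u v] /= [? ? ?]]; exists u, v. Qed.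

Lemma monomial_idealM (K : multinom n -> Prop) f g :
  (forall u v, K u -> K (mnm_add v u)) -> MI K g -> MI K (f * g).
Proof. by move=> Kup Kg m /msuppM_mem[u [v [_ /Kg ? ->]]]; exact: Kup. Qed.

Section MonomialPower.
Variables (K : multinom n -> Prop) (Q : nat -> multinom n -> Prop).
Hypotheses (Q0 : forall m, Q 0 m) (Qup : forall r u v, Q r u -> Q r (mnm_add v u))
  (QD : forall r u v, K u -> Q r v -> Q r.+1 (mnm_add u v))
  (QS : forall r m, Q r.+1 m -> exists u v, [/\ m = mnm_add u v, K u & Q r v]).

(** [QD] and [QS] say that [Q r.+1] consists of the sums of an exponent in [K] and one in [Q r]:
    computing the power becomes a question of splitting exponents. *)
Lemma monomial_ideal_pow r : ideal_pow (MI K) r = MI (Q r).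
Proof.
apply/seteqP; split.
  apply: span_min => /=.
  - exact: monomial_ideal0.
  - exact: monomial_idealD.
  - by move=> a f; apply: monomial_idealM; exact: Qup.
  move=> _ [g [Kg ->]]; elim: r g Kg => [g _ m _|r IH g Kg]; first exact: Q0.
  rewrite big_ord_recl => m /msuppM_mem[u [v [/Kg Ku /IH Qv ->]]].
  by apply: QD => //; apply: Qv => i; exact: Kg.
move=> f Qf; rewrite (mpolyE f); apply: span_sum => m /Qf.
rewrite -mul_mpolyC => Qm; apply: span_mul; move: m Qm.
elim: r {Qf} => [m _|r IH m]; first exact: pow0.
move=> /QS[u [v [-> Ku Qv]]]; rewrite mpolyXD; apply: powS; last exact: IH.
by apply/monomial_ideal_monom.
Qed.

End MonomialPower.

Lemma wdeg_ideal_pow (S : pred 'I_n) r :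
  ideal_pow (MI (fun m => 1 <= wdeg S m)%N) r = MI (fun m => r <= wdeg S m)%N.
Proof.
apply: (@monomial_ideal_pow _ (fun r m => r <= wdeg S m)%N) => //.
- by move=> {}r u v; rewrite wdegD; lia.
- by move=> {}r u v; rewrite wdegD; lia.
move=> {}r m rm; have [i Si mi] : exists2 i, S i & (0 < m i)%N.
  apply: contrapT => h; have : wdeg S m = 0%N; last by lia.
  rewrite /wdeg big1// => i _; case: (boolP (S i)) => Si; rewrite ?mul0n//.
  by case: (posnP (m i)) => [->|mi]; rewrite ?muln0//; case: h; exists i.
have [v e] := mnm_add_sub1 mi; exists (mnm1 i), v.
by move: rm; rewrite e wdegD !wdeg1 Si; split=> //; lia.
Qed.

(* The substitution [X_i |-> X_i T^(w i)]: the coefficient of [T^j] in the image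
   of [f] is the part of [f] of weight [j]. *)
Definition wgrade w : mpoly n k -> {poly mpoly n k} :=
  mmap (polyC \o @mpolyC n k) (fun i => (monom (mnm1 i))%:P * 'X^(w i)).

HB.instance Definition _ w := GRing.RMorphism.copy (wgrade w)
  (mmap (polyC \o @mpolyC n k) (fun i => (monom (mnm1 i))%:P * 'X^(w i))).

Lemma wgradeE w f :
  wgrade w f = \sum_(m <- msupp f) (mcoeff m f *: monom m)%:P * 'X^(wdeg w m).
Proof.
rewrite /wgrade /mmap; apply: eq_bigr => m _; rewrite /mmap1 /=.
under eq_bigr do rewrite exprMn -exprM -rmorphXn.
by rewrite big_split /= prodrXr -rmorph_prod -mpolyXE_id mulrA -polyCM mul_mpolyC.
Qed.

Lemma coef_wgrade w f j m :
  mcoeff m (wgrade w f)`_j = if wdeg w m == j then mcoeff m f else 0.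
Proof.
rewrite wgradeE coef_sum raddf_sum.
transitivity (\sum_(u <- msupp f | (u == m) && (wdeg w m == j)) mcoeff u f).
  rewrite [RHS]big_mkcond; apply: eq_bigr => u _.
  rewrite coefCM coefXn.
  case: (eqVneq u m) => [->|um] /=; last first.
    have [|] := eqVneq j; rewrite ?mulr1 ?mulr0 ?mcoeff0// mcoeffZ mcoeffX.
    by rewrite (negbTE um) mulr0.
  rewrite eq_sym; case: eqP => _; rewrite ?mulr1 ?mulr0 ?mcoeff0//.
  by rewrite mcoeffZ mcoeffX eqxx mulr1.
case: eqP => _; last by rewrite big1// => u; rewrite andbF.
under eq_bigl do rewrite andbT.
case: (boolP (m \in msupp f)) => mf.
  by rewrite -big_filter (filter_pred1_uniq (msupp_uniq f) mf) big_seq1.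
rewrite big1_seq; first by move: mf; rewrite -mcoeff_eq0 => /eqP.
by move=> u /andP[/eqP -> h]; rewrite h in mf.
Qed.

Lemma wgradeP w r f :
  MI (fun m => r <= wdeg w m)%N f <-> forall j, (j < r)%N -> (wgrade w f)`_j = 0.
Proof.
split=> [h j jr|h m mf].
  apply/mpolyP => m; rewrite coef_wgrade mcoeff0; case: eqP => // e.
  by apply/eqP; rewrite mcoeff_eq0; apply/negP => /h; lia.
rewrite leqNgt; apply/negP => /h /(congr1 (mcoeff m)).
rewrite coef_wgrade eqxx mcoeff0 => /eqP.
by rewrite mcoeff_eq0 mf.
Qed.

(** After the substitution, weight at least [r] means divisibility by [T^r], and [g] has a nonzero
    constant term in [T], so it cannot raise the order of [f]. *)
Lemma wdeg_ideal_primary w r f g : ~ MI (fun m => 1 <= wdeg w m)%N g ->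
  MI (fun m => r <= wdeg w m)%N (g * f) -> MI (fun m => r <= wdeg w m)%N f.
Proof.
move=> g1 /wgradeP gf; apply/wgradeP.
apply: (@low_coef_eq0 _ (wgrade w g)); last by rewrite -rmorphM.
by apply/eqP => g0; apply: g1; apply/wgradeP => -[].
Qed.

Lemma wdeg_ideal_prime (S : pred 'I_n) :
  prime_ideal (MI (fun m => 1 <= wdeg S m)%N).
Proof.
apply/prime_idealP; split.
- exact: monomial_ideal0.
- by rewrite -mpolyX0 => /monomial_ideal_monom; rewrite wdeg0.
- exact: monomial_idealD.
- by move=> a f; apply: monomial_idealM => u v; rewrite wdegD; lia.
move=> f g fg; have [|nf] := pselect (MI (fun m => 1 <= wdeg S m)%N f); first by left.
by right; exact: wdeg_ideal_primary nf fg.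
Qed.

End Monomials.

(** * Exponents of the powers and symbolic powers *)

Section WeightLemmas.
Variable n : nat.
Implicit Types (m u v : multinom n) (w : 'I_n -> nat).

Lemma wdeg_gt0 w m : (0 < wdeg w m)%N -> exists2 i, (0 < w i)%N & (0 < m i)%N.
Proof.
move=> h; apply: contrapT => e; move: h; rewrite /wdeg big1// => i _.
case: (posnP (w i)) => [->|wi]; first by rewrite mul0n.
by case: (posnP (m i)) => [->|mi]; [rewrite muln0|case: e; exists i].
Qed.

Lemma leq_wdeg w w' m : (forall i, 0 < m i -> w i <= w' i)%N -> (wdeg w m <= wdeg w' m)%N.
Proof.
move=> h; apply: leq_sum => i _.
by case: (posnP (m i)) => [->|/h mi]; rewrite ?muln0// leq_mul2r mi orbT.
Qed.

Lemma wdeg_add w w' m : wdeg (fun i => w i + w' i)%N m = (wdeg w m + wdeg w' m)%N.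
Proof. by rewrite /wdeg -big_split; apply: eq_bigr => i _ /=; rewrite mulnDl. Qed.

Lemma wdeg_mul c w m : wdeg (fun i => c * w i)%N m = (c * wdeg w m)%N.
Proof. by rewrite /wdeg big_distrr; apply: eq_bigr => i _ /=; rewrite mulnA. Qed.

Lemma wdeg_sumw (T : finType) (w : T -> 'I_n -> nat) m :
  wdeg (fun i => \sum_t w t i)%N m = (\sum_t wdeg (w t) m)%N.
Proof.
rewrite exchange_big; apply: eq_bigr => i _ /=.
by rewrite big_distrl.
Qed.

Lemma wdegMn w m t : wdeg w (mnm_muln m t) = (t * wdeg w m)%N.
Proof.
rewrite /wdeg big_distrr; apply: eq_bigr => i _ /=.
by rewrite mulmnE; lia.
Qed.

Lemma wdeg_sum (T : finType) w (u : T -> multinom n) :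
  wdeg w (\big[@mnm_add n/mnm0]_t u t) = (\sum_t wdeg w (u t))%N.
Proof. by apply: (big_morph (wdeg w)); [exact: wdegD|exact: wdeg0]. Qed.

End WeightLemmas.

Section Exponents.
Variables (N s : nat).
Implicit Types (u v : multinom N.+1) (m r : nat).

(* The coordinate line [l] is spanned by the basis vectors [2l] and [2l+1];
   the variables [X_i] with [i./2 >= s] vanish on all the lines. *)
Definition off (l : 'I_s) : pred 'I_N.+1 := fun i => i./2 != l.
Definition cw (i : 'I_N.+1) : nat := if (i./2 < s)%N then 1%N else 2%N.
Definition sym_exp (r : nat) u : Prop := forall l, (r <= wdeg (off l) u)%N.
Definition pow_exp (r : nat) u : Prop := sym_exp r u /\ (2 * r <= wdeg cw u)%N.

(** A block variable vanishes on every coordinate line but its own, an outer variable on all of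
    them. *)
Lemma sum_off i : (\sum_(l < s) off l i = s - (i./2 < s))%N.
Proof.
have [is_|is_] := ltnP i./2 s; last first.
  rewrite subn0 (eq_bigr (fun=> 1%N)); first by rewrite sum_nat_const card_ord muln1.
  move=> l _; apply/eqP; rewrite eqb1; apply/eqP => il.
  by have := ltn_ord l; rewrite -il; lia.
rewrite (bigD1 (Ordinal is_))//= {1}/off eqxx /= add0n.
rewrite (eq_bigr (fun=> 1%N)); last first.
  by move=> l; rewrite -val_eqE /= /off eq_sym => ->.
by rewrite sum1_card cardC1 card_ord subn1.
Qed.

Lemma sum_wdeg_off u :
  (\sum_(l < s) wdeg (off l) u = wdeg (fun i => s - (i./2 < s)) u)%N.
Proof. by rewrite -wdeg_sumw; apply: eq_bigr => i _; rewrite sum_off. Qed.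

Lemma sym_exp_sum m u : sym_exp m u ->
  (s * m <= wdeg (fun i : 'I_N.+1 => s - (i./2 < s)) u)%N.
Proof.
move=> um; rewrite -sum_wdeg_off -[X in (X * _)%N]card_ord -sum_nat_const.
by apply: leq_sum => l _; exact: um.
Qed.

(** Here the blocks exhaust the variables, so each variable has weight [s - 1] in the sum over the
    lines. The resulting slope [s / (s - 1)] is [(N + 1) / (N - 1)]. *)
Lemma sym_exp_full m u : (2 * s = N + 1)%N -> sym_exp m u ->
  (s * m <= (s - 1) * mdeg u)%N.
Proof.
move=> e /sym_exp_sum /leq_trans; apply; rewrite mdeg_wdeg -wdeg_mul.
apply: leq_wdeg => i _; rewrite muln1; have := ltn_ord i; lia.
Qed.

(** The witness is the product of the [b]-th powers of one variable from each block. Its weights off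
    the lines are all equal, which makes it extremal for the resurgence and, without outer
    variables, for the least degree. *)
Lemma exists_sym_exp_blocks b : (2 * s <= N + 1)%N -> exists u,
  [/\ forall l, wdeg (off l) u = ((s - 1) * b)%N, wdeg cw u = (s * b)%N
    & mdeg u = (s * b)%N].
Proof.
move=> hsN; have lt l : (l < s)%N -> (l.*2 < N.+1)%N by lia.
pose e (l : 'I_s) : 'I_N.+1 := Ordinal (lt l (ltn_ord l)).
exists (\big[@mnm_add _/mnm0]_l mnm_muln (mnm1 (e l)) b).
have wE w c : (forall l, w (e l) = c) ->
    wdeg w (\big[@mnm_add _/mnm0]_l mnm_muln (mnm1 (e l)) b) = (s * (b * c))%N.
  move=> h; rewrite wdeg_sum (eq_bigr (fun=> b * c)%N).
    by rewrite sum_nat_const card_ord.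
  by move=> l _; rewrite wdegMn wdeg1 h.
split.
- move=> l; rewrite wdeg_sum (bigD1 l)//= wdegMn wdeg1 /off /= doubleK eqxx muln0.
  rewrite add0n (eq_bigr (fun=> b)) => [|j jl]; last first.
    by rewrite wdegMn wdeg1 /= doubleK [(_ == _ :> nat)](negbTE jl) muln1.
  by rewrite sum_nat_const cardC1 card_ord subn1.
- by rewrite (wE _ 1%N) ?muln1// => l; rewrite /cw /= doubleK ltn_ord.
- by rewrite mdeg_wdeg (wE _ 1%N) ?muln1.
Qed.

(** The last variable is outer, so its [m]-th power vanishes to order [m] on every line. *)
Lemma exists_sym_exp_free m : (2 * s < N + 1)%N ->
  exists2 u, sym_exp m u & mdeg u = m.
Proof.
move=> h; exists (mnm_muln (mnm1 ord_max) m); last by rewrite mdeg_wdeg wdegMn wdeg1 muln1.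
move=> l; rewrite wdegMn wdeg1 /off /=; have := ltn_ord l.
by case: eqP; lia.
Qed.

Hypothesis hs : (1 <= s)%N.

Let l0 : 'I_s := Ordinal hs.

Lemma sym_exp_mdeg r u : sym_exp r u -> (r <= mdeg u)%N.
Proof.
move=> /(_ l0) /leq_trans; apply; rewrite mdeg_wdeg; apply: leq_wdeg => i _.
by case: (off _ _).
Qed.

(** The only monomials of positive degree with [cw]-weight below 2 are single block variables, and
    such a variable does not vanish on its own line. *)
Lemma sym_exp1_pow u : sym_exp 1 u -> pow_exp 1 u.
Proof.
move=> u1; split => //; rewrite leqNgt; apply/negP => c1.
have d1 : mdeg u = 1%N.
  apply/eqP; rewrite eqn_leq sym_exp_mdeg// andbT.
  suff : (mdeg u <= wdeg cw u)%N by lia.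
  by rewrite mdeg_wdeg; apply: leq_wdeg => i _; rewrite /cw; case: ifP.
have /mdeg1P[i /eqP e] : mdeg u == 1%N by rewrite d1.
move: c1; rewrite e wdeg1 /cw; case: ifP => // is_ _.
by have := u1 (Ordinal is_); rewrite e wdeg1 /off eqxx.
Qed.

(* Greedy choice of a generator: an outer variable if one occurs, otherwise one
   variable from each of the two largest blocks. *)
Lemma pow_exp_split r u : pow_exp r.+1 u ->
  exists v w, [/\ u = mnm_add v w, sym_exp 1 v & pow_exp r w].
Proof.
move=> [us uc]; have [[i [is_ ui]]|noE] :=
    pselect (exists i : 'I_N.+1, (s <= i./2)%N /\ (0 < u i)%N).
  have [v e] := mnm_add_sub1 ui; exists (mnm1 i), v.
  have oi l : off l i by apply/eqP => il; have := ltn_ord l; rewrite -il; lia.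
  split=> //; first by move=> l; rewrite wdeg1 oi.
  split=> [l|]; first by have := us l; rewrite e wdegD wdeg1 oi; lia.
  by move: uc; rewrite e wdegD wdeg1 /cw ltnNge is_ /=; lia.
have inB i : (0 < u i)%N -> (i./2 < s)%N.
  by move=> ui; rewrite ltnNge; apply/negP => h; apply: noE; exists i.
pose b l := wdeg (fun i => ~~ off l i) u.
have cwE : wdeg cw u = mdeg u.
  rewrite mdeg_wdeg; apply/eqP; rewrite eqn_leq !leq_wdeg// => i /inB; rewrite /cw => -> //.
have bE l : (wdeg (off l) u + b l)%N = mdeg u.
  rewrite -wdeg_add mdeg_wdeg; apply/eqP.
  by rewrite eqn_leq !leq_wdeg// => i _; case: (off l i).
pose p := [arg max_(l > l0) b l].
have pmax l : (b l <= b p)%N by rewrite /p; case: arg_maxnP => // j _ /(_ l); apply.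
(* The weight off the largest block is at least [r + 1], so some other block is occupied. *)
have [q0 [q0p bq0]] : exists q0, q0 != p /\ (0 < b q0)%N.
  have [i] := wdeg_gt0 (leq_trans (ltn0Sn r) (us p)).
  rewrite lt0b => oi ui; exists (Ordinal (inB i ui)); split.
    by move: oi; rewrite /off; apply: contra => /eqP <-.
  rewrite /b (leq_trans ui)// /wdeg (bigD1 i)//=.
  by rewrite /off eqxx /= mul1n leq_addr.
pose q := [arg max_(l > q0 | l != p) b l].
have [qp qmax] : q != p /\ forall l, l != p -> (b l <= b q)%N.
  by rewrite /q; case: arg_maxnP.
have pick l : (0 < b l)%N -> exists2 i : 'I_N.+1, i./2 = l & (0 < u i)%N.
  by move=> /wdeg_gt0[i]; rewrite lt0b negbK => /eqP; exists i.
have [i ip ui] := pick p (leq_trans bq0 (pmax q0)).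
have [j jq uj] := pick q (leq_trans bq0 (qmax q0 q0p)).
have [v e] := mnm_add_sub1 ui.
have [v' e'] : exists v', v = mnm_add (mnm1 j) v'.
  apply: mnm_add_sub1; move: uj; rewrite e mnmDE mnm1E; case: eqP => // ij.
  by move: qp; rewrite -val_eqE /= -ip -jq ij eqxx.
have we w : wdeg w u = (w i + w j + wdeg w v')%N by rewrite e e' !wdegD !wdeg1 addnA.
have oi l : off l i = (p != l) by rewrite /off ip.
have oj l : off l j = (q != l) by rewrite /off jq.
exists (mnm_add (mnm1 i) (mnm1 j)), v'; split.
- by rewrite e e'; apply/mnmP => t; rewrite !mnmDE addnA.
- move=> l; rewrite wdegD !wdeg1 oi oj; case: (eqVneq p l) => [<-|//].
  by rewrite qp.
have ci : cw i = 1%N by rewrite /cw inB.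
have cj : cw j = 1%N by rewrite /cw inB.
split; last by move: uc; rewrite we ci cj; lia.
move=> l; have := us l; have := we (off l); rewrite oi oj.
have [<-|pl] := eqVneq p l; first by rewrite qp /=; lia.
have [<-|ql] /= := eqVneq q l; first by lia.
(* Critical case: both removed variables count off [l], so a surplus of one is needed. If the weight
   off [l] were only [r + 1], total degree at least [2(r + 1)] would force [b l] to be at least
   [r + 1]; the blocks [p] and [q], at least as large, would then give weight at least [2(r + 1)]
   off [l]. *)
suff : (r.+2 <= wdeg (off l) u)%N by lia.
have lp : l != p by rewrite eq_sym.
have bpq : (b p + b q <= wdeg (off l) u)%N.
  rewrite -wdeg_add; apply: leq_wdeg => t _; rewrite /off !negbK.
  case: (eqVneq (nat_of_ord t)./2 p) => [->|_] /=.
    by rewrite [(p : nat) == l](negbTE pl) [(p : nat) == q]eq_sym [(q : nat) == p](negbTE qp).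
  by case: eqP => //= ->; rewrite [(q : nat) == l](negbTE ql).
have := bE l; have := pmax l; have := qmax l lp; move: uc; rewrite cwE; lia.
Qed.

Lemma sym_exp_not_pow m r u : sym_exp m u -> ~ pow_exp r u ->
  (m < r)%N \/ (2 <= s)%N /\ (m * s < 2 * (s - 1) * r)%N.
Proof.
move=> um nr; have [|rm] := ltnP m r; [by left|right].
have uc : (wdeg cw u < 2 * r)%N.
  rewrite ltnNge; apply/negP => h; apply: nr; split => // l.
  exact: leq_trans (um l).
have [s2|s1] := leqP 2 s; last first.
  suff : (2 * m <= wdeg cw u)%N by lia.
  (* For a single line only the outer variables count off it, and [cw] counts them twice: the degree
     condition is automatic. *)
  apply: (leq_trans (_ : _ <= 2 * wdeg (off l0) u)%N).
    by rewrite leq_mul2l um.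
  rewrite -wdeg_mul; apply: leq_wdeg => i _; rewrite /off /cw /=.
  case: ltnP => // ; lia.
split => //; suff : (s * m <= (s - 1) * wdeg cw u)%N by nia.
(* Variable by variable: a block variable has weight [s - 1] on both sides, an outer one [s] against
   [2(s - 1)], which uses that [s] is at least 2. *)
apply: leq_trans (sym_exp_sum um) _; rewrite -wdeg_mul; apply: leq_wdeg => i _.
by rewrite /cw; case: ltnP => _ /=; nia.
Qed.

(** The first and last variables lie in no common block, so each line kills at least one of them. On
    the first line only the last variable counts, and the order there is exactly [m]. *)
Lemma exists_sym_exp_ends m : (2 <= N)%N -> (2 * s <= N + 1)%N ->
  exists u, sym_exp m u /\ forall r, (m < r)%N -> ~ pow_exp r u.
Proof.
move=> hN hsN; exists (mnm_add (mnm_muln (mnm1 ord0) m) (mnm_muln (mnm1 ord_max) m)); split.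
  move=> l; rewrite wdegD !wdegMn !wdeg1 /off /=.
  by do 2![case: eqP => /=]; lia.
move=> r mr [/(_ l0)]; rewrite wdegD !wdegMn !wdeg1 /off /=.
by case: eqP => _; lia.
Qed.

End Exponents.

(** * Resurgences and Waldschmidt constants from arithmetic criteria *)

Section Suprema.
Variables (R : realType) (p q : nat).
Hypotheses (hp : (0 < p)%N) (hq : (0 < q)%N).

Lemma le_ratio (m r : nat) : (0 < r)%N -> (m * q < p * r)%N ->
  ((m%:R / r%:R)%:E <= (p%:R / q%:R : R)%:E)%E.
Proof.
move=> r0 /ltnW mr; rewrite lee_fin ler_pdivrMr ?ltr0n// mulrAC.
by rewrite ler_pdivlMr ?ltr0n// -!natrM ler_nat.
Qed.

(** The fractions [(p n - 1) / (q n)] satisfy the strict inequality and tend to [p / q]. *)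
Lemma ratio_dense (y : \bar R) :
  (forall m r, (0 < m)%N -> (0 < r)%N -> (m * q < p * r)%N ->
     ((m%:R / r%:R)%:E <= y)%E) -> ((p%:R / q%:R)%:E <= y)%E.
Proof.
move=> h; apply/lee_subgt0Pr => e e0.
(* Exceeding [1 / e] makes the error [1 / (q n)] at most [e]; being at least 2 keeps [p n - 1]
   positive even for [p = 1]. *)
pose n := (Num.truncn e^-1).+2.
have n2 : (1 < n)%N by [].
have pn : (1 < p * n)%N by nia.
apply: (le_trans _ (h (p * n - 1)%N (q * n)%N _ _ _)).
- rewrite -EFinB lee_fin natrB; last lia.
  rewrite mulrBl lerB//.
    by rewrite !natrM -mulf_div divff ?mulr1// pnatr_eq0.
  rewrite mul1r -[leRHS]invrK lef_pV2 ?posrE ?invr_gt0 ?ltr0n ?muln_gt0 ?hq//.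
  apply/ltW/(lt_le_trans (truncnS_gt _)).
  by rewrite ler_nat (leq_trans (leqnSn _))// leq_pmull.
- by rewrite subn_gt0.
- by rewrite muln_gt0 hq.
- by rewrite [(q * n)%N]mulnC mulnA ltn_pmul2r//; lia.
Qed.

Variables (A : idomainType) (I : set A).
Hypotheses (noncont_lt : forall m r, ~ symbolic_power I m `<=` ideal_pow I r ->
    (m * q < p * r)%N)
  (lt_noncont : forall m r, (m * q < p * r)%N -> exists T, forall t, (T <= t)%N ->
    ~ symbolic_power I (m * t) `<=` ideal_pow I (r * t)).

Lemma asymptotic_resurgence_ratio : asymptotic_resurgence R I = (p%:R / q%:R)%:E.
Proof.
apply/eqP; rewrite eq_le; apply/andP; split.
  apply: ge_ereal_sup => _ [m [r [m0 r0 [T _ HT] ->]]].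
  apply: le_ratio => //; have := noncont_lt (HT T.+1 (leqnSn T)); nia.
apply: ratio_dense => m r m0 r0 /lt_noncont[T HT]; apply: ereal_sup_ubound.
by exists m, r; split => //; exists T.
Qed.

(** Multiplying [m] and [r] by [T + t + 1] keeps the ratio and passes both thresholds [T] and [t].
    The value is thus independent of [t], and the upper limit is that of a constant sequence. *)
Lemma resurgence_from_ratio t : resurgence_from R I t = (p%:R / q%:R)%:E.
Proof.
apply/eqP; rewrite eq_le; apply/andP; split.
  by apply: ge_ereal_sup => _ [m [r [[m0 r0] _ /noncont_lt mr ->]]]; exact: le_ratio.
apply: ratio_dense => m r m0 r0 /lt_noncont[T HT]; apply: ereal_sup_ubound.
exists (m * (T + t).+1)%N, (r * (T + t).+1)%N; split; rewrite ?muln_gt0 ?m0 ?r0//.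
- by split; nia.
- by apply: HT; lia.
by rewrite !natrM -mulf_div divff ?mulr1// pnatr_eq0.
Qed.

Lemma asymptotic_resurgence'_ratio : asymptotic_resurgence' R I = (p%:R / q%:R)%:E.
Proof.
have -> : asymptotic_resurgence' R I = limn_esup (cst (p%:R / q%:R : R)%:E).
  by congr limn_esup; apply/funext => t; exact: resurgence_from_ratio.
by rewrite (cvg_limn_einf_sup (cvg_cst _)).
Qed.

Lemma resurgence_ratio : resurgence R I = (p%:R / q%:R)%:E.
Proof.
apply/eqP; rewrite eq_le; apply/andP; split.
  by apply: ge_ereal_sup => _ [m [r [m0 r0 /noncont_lt mr ->]]]; exact: le_ratio.
rewrite -(resurgence_from_ratio 0); apply: le_ereal_sup => _ [m [r [[m0 r0] _ mr ->]]].
by exists m, r.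
Qed.

End Suprema.

Section WaldschmidtLimit.
Variables (R : realType) (k : fieldType) (n : nat).
Implicit Types (J : set (mpoly n k)).

Lemma least_degree_alpha J f : J f -> f != 0 -> is_least_degree J (alpha J).
Proof.
move=> Jf f0; apply: xgetPex.
pose P d := `[< exists g, [/\ J g, g != 0 & (msize g).-1 = d] >].
have exP : exists d, P d by exists (msize f).-1; apply/asboolP; exists f.
exists (ex_minn exP); case: ex_minnP => d /asboolP dP dmin; split => // g Jg g0.
by apply: dmin; apply/asboolP; exists g.
Qed.

Variables (I : set (mpoly n k)) (a b c : nat).
Hypotheses (hb : (0 < b)%N)
  (lower : forall m f, symbolic_power I m f -> f != 0 -> (a * m <= b * (msize f).-1)%N)
  (upper : forall m, exists f,
    [/\ symbolic_power I m f, f != 0 & (b * (msize f).-1 <= a * m + c)%N]).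

Lemma waldschmidt_cvg : waldschmidt_seq R I x @[x --> \oo] --> (a%:R / b%:R : R).
Proof.
(* Since [harmonic m] is [1 / (m + 1)], the factor 2 absorbs the passage from [c / m] to
   [c / (m + 1)] for positive [m]. *)
apply: (@squeeze_cvgr _ _ _ _ (cst (a%:R / b%:R))
  (fun m => a%:R / b%:R + (2 * c)%:R * harmonic m)); last 2 first.
- exact: cvg_cst.
- rewrite -[X in _ --> X]addr0; apply: cvgD; first exact: cvg_cst.
  by rewrite -[X in _ --> X](mulr0 (2 * c)%:R); apply: cvgMr; exact: cvg_harmonic.
exists 1%N => // m /= m0.
have [f [If f0 fc]] := upper m; have [[g [Ig g0 ge]] gmin] := least_degree_alpha If f0.
rewrite /waldschmidt_seq; set d := alpha _ in ge gmin *.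
have lo : (a * m <= b * d)%N by rewrite -ge; exact: lower.
have up : (b * d <= a * m + c)%N by rewrite (leq_trans _ fc)// leq_mul2l gmin ?orbT.
have b0 : 0 < b%:R :> R by rewrite ltr0n.
have m0' : 0 < m%:R :> R by rewrite ltr0n.
apply/andP; split.
  by rewrite ler_pdivrMr// mulrAC ler_pdivlMr// -!natrM ler_nat mulnC [(d * _)%N]mulnC mulnC.
rewrite /harmonic /= ler_pdivrMr// mulrDl.
have h1 : c%:R <= (2 * c)%:R / m.+1%:R * m%:R :> R.
  by rewrite mulrAC ler_pdivlMr ?ltr0n// -!natrM ler_nat; nia.
have h2 : d%:R <= a%:R / b%:R * m%:R + c%:R :> R.
  rewrite mulrAC -[c%:R](@mulfK _ b%:R) ?lt0r_neq0// -mulrDl ler_pdivlMr//.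
  by rewrite -!natrM -natrD ler_nat; nia.
by apply: (le_trans h2); rewrite lerD2l.
Qed.

End WaldschmidtLimit.

(** * Linear changes of variables *)

Section WeightedHomogeneous.
Variables (k : fieldType) (n : nat).
Implicit Types (f g : mpoly n k) (w : 'I_n -> nat).
Local Notation monom m := (@mpolyX n k m).
Local Notation MI := (monomial_ideal k n).

Definition whomog w (d : nat) : set (mpoly n k) := MI (fun m => wdeg w m = d).

Lemma whomog_monom w d m : wdeg w m = d -> whomog w d (monom m).
Proof. by move=> e; apply/monomial_ideal_monom. Qed.

Lemma whomogC w c : whomog w 0 (mpolyC n c).
Proof.
by move=> m; rewrite msuppC; case: ifP => //= _; rewrite inE => /eqP ->; exact: wdeg0.
Qed.

Lemma whomog1 w : whomog w 0 1.
Proof. by rewrite -mpolyC1; exact: whomogC. Qed.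

Lemma whomogM w d e f g : whomog w d f -> whomog w e g -> whomog w (d + e)%N (f * g).
Proof. by move=> fd ge m /msuppM_mem[u [v [/fd <- /ge <- ->]]]; exact: wdegD. Qed.

Lemma whomogZ w d c f : whomog w d f -> whomog w d (c *: f).
Proof. by move=> fd m /msuppZ_le; exact: fd. Qed.

Lemma whomog_sum (T : finType) w d (F : T -> mpoly n k) :
  (forall t, whomog w d (F t)) -> whomog w d (\sum_t F t).
Proof.
by move=> Fd; elim/big_ind: _ => //; [exact: monomial_ideal0|exact: monomial_idealD].
Qed.

Lemma whomog_prod (T : finType) w (d : T -> nat) (F : T -> mpoly n k) :
  (forall t, whomog w (d t) (F t)) -> whomog w (\sum_t d t)%N (\prod_t F t).
Proof.
move=> Fd; by apply: (big_ind2 (whomog w)) => //; [exact: whomog1|move=> *; exact: whomogM].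
Qed.

Lemma whomogXn w d f e : whomog w d f -> whomog w (d * e)%N (f ^+ e).
Proof.
move=> fd; elim: e => [|e IH]; first by rewrite muln0; exact: whomog1.
by rewrite exprS mulnS; exact: whomogM.
Qed.

End WeightedHomogeneous.

Section LinearSubstitution.
Variables (k : fieldType) (n : nat).
Implicit Types (M : 'M[k]_n) (f g : mpoly n k).
Local Notation monom m := (@mpolyX n k m).

(* [f(x)] is sent to [f(x M)], with [x] the row vector of variables. *)
Definition lsubst M : mpoly n k -> mpoly n k :=
  comp_mpoly (mktuple (fun j => \sum_i M i j *: monom (mnm1 i))).

HB.instance Definition _ M := GRing.RMorphism.copy (lsubst M)
  (comp_mpoly (mktuple (fun j => \sum_i M i j *: monom (mnm1 i)))).

Lemma lsubstX M j : lsubst M (monom (mnm1 j)) = \sum_i M i j *: monom (mnm1 i).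
Proof. by rewrite /lsubst comp_mpolyXU -tnth_nth tnth_mktuple. Qed.

Lemma lsubstZ M c f : lsubst M (c *: f) = c *: lsubst M f.
Proof. exact: comp_mpolyZ. Qed.

Lemma lsubst_eval M f (v : 'I_n -> k) :
  meval v (lsubst M f) = meval (fun j => \sum_i v i * M i j) f.
Proof.
rewrite /lsubst comp_mpoly_meval; apply: meval_eq => j; rewrite tnth_mktuple.
rewrite raddf_sum; apply: eq_bigr => i _.
by rewrite /= mevalZ mevalXU mulrC.
Qed.

Lemma lsubstE M f : lsubst M f = \sum_(m <- msupp f) mcoeff m f *:
  \prod_j (\sum_i M i j *: monom (mnm1 i)) ^+ m j.
Proof.
rewrite /lsubst comp_mpolyEX; apply: eq_bigr => m _; congr (_ *: _).
by rewrite comp_mpolyX; apply: eq_bigr => j _; rewrite tnth_mktuple.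
Qed.

Lemma lsubst_comp M M' f : lsubst M (lsubst M' f) = lsubst (M *m M') f.
Proof.
rewrite [lsubst M' f]lsubstE rmorph_sum [RHS]lsubstE; apply: eq_bigr => m _ /=.
rewrite lsubstZ rmorph_prod; congr (_ *: _); apply: eq_bigr => j _.
rewrite rmorphXn; congr (_ ^+ _); rewrite rmorph_sum /=.
under eq_bigr do rewrite lsubstZ lsubstX scaler_sumr.
rewrite exchange_big; apply: eq_bigr => i _ /=; rewrite mxE scaler_suml.
by apply: eq_bigr => l _; rewrite scalerA mulrC.
Qed.

Lemma lsubst1 f : lsubst 1%:M f = f.
Proof.
rewrite -[RHS]comp_mpoly_id /lsubst; congr comp_mpoly; apply: eq_mktuple => j.
rewrite (bigD1 j)//= mxE eqxx scale1r big1 ?addr0// => i ij.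
by rewrite mxE (negbTE ij) scale0r.
Qed.

(** Substituting linear forms sends a term to terms of the same degree; hence homogeneity is
    preserved and the degree does not grow. *)
Lemma lsubst_supp M f u : u \in msupp (lsubst M f) ->
  exists2 m, m \in msupp f & mdeg u = mdeg m.
Proof.
rewrite lsubstE => /msupp_sum_le; rewrite filter_predT => /flatten_mapP[m mf].
move=> /msuppZ_le uP; exists m => //.
have linear j : whomog (fun=> 1%N) 1 (\sum_i M i j *: monom (mnm1 i)).
  by apply: whomog_sum => i; apply/whomogZ/whomog_monom; rewrite wdeg1.
rewrite !mdeg_wdeg; apply: (whomog_prod _ uP) => j.
by rewrite mul1n -[X in whomog _ X]mul1n; exact: whomogXn.
Qed.

Lemma lsubst_whomog M d f : whomog (fun=> 1%N) d f -> whomog (fun=> 1%N) d (lsubst M f).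
Proof. by move=> fd u /lsubst_supp[m /fd <-]; rewrite !mdeg_wdeg. Qed.

Lemma msize_lsubst M f : (msize (lsubst M f) <= msize f)%N.
Proof.
rewrite [X in (X <= _)%N]msizeE; apply/bigmax_leqP_seq => u /lsubst_supp[m mf ->] _.
exact: msize_mdeg_lt.
Qed.

Lemma lsubstK M M' : M' *m M = 1%:M -> cancel (lsubst M) (lsubst M').
Proof. by move=> e f; rewrite lsubst_comp e lsubst1. Qed.

End LinearSubstitution.

(** Algebraic closedness enters here: [p + 1] has no root, so it is constant. *)
Lemma horner_eq0 (k : closedFieldType) (p : {poly k}) :
  (forall x, p.[x] = 0) -> p = 0.
Proof.
move=> p0; have : ~~ (size (p + 1) != 1%N).
  by apply/closed_rootP => -[x]; rewrite rootE hornerD p0 add0r hornerC oner_eq0.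
rewrite negbK => /size_poly1P[c _ e].
have pc : p = (c - 1)%:P by rewrite polyCB -e addrK.
by have := p0 0; rewrite pc hornerC => ->; rewrite polyC0.
Qed.

(** * The ideal of a single line *)

Section CoordinateLine.
Variables (k : closedFieldType) (N s : nat).
Hypothesis (hsN : (2 * s <= N + 1)%N).
Variable l : 'I_s.
Implicit Types (u : multinom N.+1) (g : mpoly N.+1 k).
Local Notation MI := (monomial_ideal k N.+1).

Lemma ev_proof : (l.*2 < N.+1)%N.
Proof. by have := ltn_ord l; lia. Qed.
Lemma od_proof : (l.*2.+1 < N.+1)%N.
Proof. by have := ltn_ord l; lia. Qed.
Definition ev : 'I_N.+1 := Ordinal ev_proof.
Definition od : 'I_N.+1 := Ordinal od_proof.

Lemma off_ev : off l ev = false.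
Proof. by rewrite /off /= doubleK eqxx. Qed.

Lemma off_od : off l od = false.
Proof. by rewrite /off /= uphalf_double eqxx. Qed.

Lemma off_false i : off l i = false -> i = ev \/ i = od.
Proof.
move/negbFE/eqP => e; case: (boolP (odd i)) => oi; [right|left]; apply: val_inj => /=.
  by rewrite -e -[LHS]odd_double_half oi.
by rewrite -e -[LHS]odd_double_half (negbTE oi).
Qed.

Lemma od_ev : od != ev.
Proof. by rewrite -val_eqE /=; lia. Qed.

Lemma sum_block (V : nmodType) (F : 'I_N.+1 -> V) :
  (forall i, off l i -> F i = 0) -> \sum_i F i = F ev + F od.
Proof.
move=> F0; rewrite (bigD1 ev)//= (bigD1 od) ?od_ev//= big1 ?addr0// => i /andP[ie io].
apply: F0; case E: (off l i) => //.
by case: (off_false E) ie io => ->; rewrite eqxx.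
Qed.

Lemma wdeg_off_eq0 u : wdeg (off l) u = 0%N -> forall i, off l i -> u i = 0%N.
Proof.
move=> /eqP; rewrite /wdeg sum_nat_eq0 => /forallP h i oi.
by have := h i; rewrite /= oi mul1n => /eqP.
Qed.

(* Restriction to the affine chart [t |-> t e_(2l) + e_(2l+1)] of the line. *)
Let h (i : 'I_N.+1) : {poly k} := if i == ev then 'X else if i == od then 1 else 0.

Lemma mmap1_chart u :
  mmap1 h u = if wdeg (off l) u == 0%N then 'X^(u ev) else 0.
Proof.
case: (posnP (wdeg (off l) u)) => [u0|/wdeg_gt0[i]] /=.
  rewrite /mmap1 (bigD1 ev)//= {1}/h eqxx big1 ?mulr1// => i ie.
  rewrite /h (negbTE ie); case: eqP => [_|io]; first by rewrite expr1n.
  rewrite (wdeg_off_eq0 u0) ?expr0//; case E: (off l i) => //.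
  by case: (off_false E) io ie => -> //; rewrite eqxx.
rewrite lt0b => oi ui.
rewrite /mmap1 (bigD1 i)//= /h.
have -> : i == ev = false by apply/eqP => e; move: oi; rewrite e off_ev.
have -> : i == od = false by apply/eqP => e; move: oi; rewrite e off_od.
by rewrite expr0n -leqn0 leqNgt ui mul0r.
Qed.

(** Among monomials of degree [d] in the two block variables, the exponent of [ev] determines the
    monomial. Distinct ones therefore restrict to distinct powers on the chart, and each coefficient
    can be read off there. *)
Lemma vanish_coordinate_line d g : whomog (fun=> 1%N) d g ->
  (forall t, meval (fun i => if i == ev then t else if i == od then 1 else 0) g = 0) ->
  MI (fun u => 1 <= wdeg (off l) u)%N g.
Proof.
move=> gd g0 u ug; rewrite lt0n; apply/negP => /eqP u0.
have q0 : mmap (@polyC k) h g = 0.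
  apply: horner_eq0 => t; rewrite -[RHS](g0 t) /mmap mevalE horner_sum.
  apply: eq_bigr => m _; rewrite hornerM hornerC; congr (_ * _).
  rewrite /mmap1 horner_prod; apply: eq_bigr => i _.
  by rewrite horner_exp /h; case: (i == ev); [|case: (i == od)]; rewrite ?hornerE.
have degE m : wdeg (off l) m = 0%N -> wdeg (fun=> 1%N) m = (m ev + m od)%N.
  move=> m0; rewrite /wdeg; under eq_bigr do rewrite mul1n.
  by apply: (sum_block (F := m)); exact: wdeg_off_eq0.
have : (mmap (@polyC k) h g)`_(u ev) = 0 by rewrite q0 coef0.
rewrite /mmap coef_sum (bigD1_seq u) ?msupp_uniq//= mmap1_chart u0 eqxx.
rewrite coefCM coefXn eqxx mulr1 big1_seq ?addr0 => [/eqP|m /andP[mu mg]].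
  by rewrite mcoeff_eq0 ug.
rewrite mmap1_chart coefCM; case: eqP => m0; last by rewrite coef0 mulr0.
rewrite coefXn; case: eqP => [e|_]; last by rewrite mulr0.
case/eqP: mu; apply/mnmP => i; case E: (off l i).
  by rewrite !wdeg_off_eq0.
have := degE _ m0; have := degE _ u0; rewrite (gd _ mg) (gd _ ug) => {}E1 E2.
by case: (off_false E) => ->; lia.
Qed.

Variables (L : line k N) (M M' : 'M[k]_N.+1).
Hypotheses (MM' : M *m M' = 1%:M) (M'M : M' *m M = 1%:M)
  (LM : forall v, v \in val L <-> exists2 w : 'rV_N.+1,
     (forall i, off l i -> w 0 i = 0) & v = w *m M).

Lemma line_idealE :
  line_ideal L = lsubst M @^-1` MI (fun u => 1 <= wdeg (off l) u)%N.
Proof.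
apply/seteqP; split=> [|f /= fM].
  apply: span_min => /=.
  - by rewrite rmorph0; exact: monomial_ideal0.
  - by move=> f g; rewrite rmorphD; exact: monomial_idealD.
  - by move=> a f ff; rewrite rmorphM; apply: monomial_idealM ff => u v; rewrite wdegD; lia.
  move=> f [[d /dhomogP fd] f0]; apply: (@vanish_coordinate_line d).
    by apply: lsubst_whomog => m /fd; rewrite -mdeg_wdeg.
  move=> t; rewrite lsubst_eval.
  pose w : 'rV[k]_N.+1 := \row_i (if i == ev then t else if i == od then 1 else 0).
  rewrite -[RHS](f0 (w *m M)); last 2 first.
  - apply/LM; exists w => // i oi; rewrite mxE.
    case: eqP => [e|_]; first by move: oi; rewrite e off_ev.
    by case: eqP => [e|//]; move: oi; rewrite e off_od.
  - apply/eqP => /(congr1 (mulmxr M')); rewrite /= -mulmxA MM' mulmx1 mul0mx.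
    move/rowP/(_ od); rewrite !mxE (negbTE od_ev) eqxx => /eqP.
    by rewrite oner_eq0.
  apply: meval_eq => j; rewrite /pt_coord mxE; apply: eq_bigr => i _.
  by rewrite mxE.
(* Each term of [lsubst M f] contains a variable off [l]; [lsubst M'] turns that variable into a
   linear form vanishing on [L], that is, a generator. *)
rewrite -(lsubstK M'M f) (mpolyE (lsubst M f)) rmorph_sum.
apply: span_sum => m /fM /wdeg_gt0[i]; rewrite lt0b => oi mi /=.
have [v ->] := mnm_add_sub1 mi.
rewrite mpolyXD -mul_mpolyC mulrCA mulrC rmorphM; apply/span_mul/span_gen; split.
  exists 1%N; apply/dhomogP => u /lsubst_supp[u'].
  by rewrite msupp_monom => /eqP -> e; exact: etrans e (mdeg1 _).
move=> x /LM[w w0 ->] _; rewrite lsubst_eval mevalXU.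
transitivity ((w *m M *m M') 0 i); last by rewrite -mulmxA MM' mulmx1 w0.
by rewrite mxE; apply: eq_bigr => j _.
Qed.

End CoordinateLine.

(** * General lines are independent *)

Section GeneralLines.
Variables (k : closedFieldType) (N s : nat).
Hypothesis (hsN : (2 * s <= N + 1)%N).
Implicit Types (L : 'I_s -> line k N) (l : 'I_s).
Local Notation ev := (ev hsN).
Local Notation od := (od hsN).

Lemma line_basis (L : line k N) : exists u v : 'rV[k]_N.+1,
  (forall x, x \in val L <-> exists a b, x = a *: u + b *: v) /\
  (forall i j, plucker L i j = u 0 i * v 0 j - u 0 j * v 0 i).
Proof.
rewrite /plucker; set b := vbasis (val L).
have sb : size (b : seq _) = 2%N by rewrite size_tuple; apply/eqP; exact: (valP L).
have VE : val L = (<[b`_0]> + <[b`_1]>)%VS.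
  rewrite -{1}(span_basis (vbasisP (val L))) -/b.
  case: (b : seq _) sb => [|x0 [|x1 []]]//= _.
  by rewrite span_cons span_seq1.
exists b`_0, b`_1; split => // x; move: b`_0 b`_1 VE => u v ->.
split; last by move=> [a [c ->]]; rewrite memv_add ?memvZ ?memv_line.
by move=> /memv_addP[_ /vlineP[a ->] [_ /vlineP[c ->] ->]]; exists a, c.
Qed.

(* The rows of index [2l] and [2l+1] lie on the line [l], so the lines are
   independent as soon as this matrix is invertible. *)
Definition line_mx L : 'M[k]_N.+1 := \matrix_(i, j)
  if insub i./2 is Some l then plucker (L l) i j else (i == j)%:R.

Definition line_mx_poly : 'M[mpoly #|plucker_index N s| k]_N.+1 := \matrix_(i, j)
  if insub i./2 is Some l
  then mpolyX k (mnm1 (enum_rank (l, (i, j)) : 'I_#|plucker_index N s|))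
  else (i == j)%:R.

Lemma plucker_eval_det L : plucker_eval (\det line_mx_poly) L = \det (line_mx L).
Proof.
rewrite /plucker_eval -det_map_mx; congr (\det _); apply/matrixP => i j.
rewrite !mxE; case: insubP => [l _ _|_]; last by rewrite rmorph_nat.
by rewrite /= mevalXU enum_rankK.
Qed.

(** Each product in the Leibniz expansion takes one entry from every row: a Pluecker coordinate of
    line [l] from each row of block [l], a constant from each outer row. *)
Lemma multihomogeneous_det : multihomogeneous (\det line_mx_poly).
Proof.
move=> l; exists (\sum_(i < N.+1) (i./2 == l :> nat))%N.
suff h : whomog (fun e : 'I_#|plucker_index N s| => (enum_val e).1 == l)
    (\sum_(i < N.+1) (i./2 == l :> nat))%N (\det line_mx_poly).
  move=> m /h <-; rewrite big_mkcond; apply: eq_bigr => e _.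
  by case: eqP; rewrite ?mul1n ?mul0n.
apply: whomog_sum => p.
have hp : whomog (fun e : 'I_#|plucker_index N s| => (enum_val e).1 == l)
    (\sum_(i < N.+1) (i./2 == l :> nat))%N (\prod_i line_mx_poly i (p i)).
  apply: whomog_prod => i; rewrite mxE; case: insubP => [l' _ <-|is_].
    by apply: whomog_monom; rewrite wdeg1 enum_rankK.
  have -> : (i./2 == l :> nat) = false.
    by apply/eqP => e; move: is_; rewrite e ltn_ord.
  by rewrite -mpolyC_nat; exact: whomogC.
case: (odd_perm p); first by rewrite expr1 mulN1r -scaleN1r; exact: whomogZ.
by rewrite expr0 mul1r.
Qed.

Lemma insub_ev l : insub (ev l)./2 = Some l.
Proof. by rewrite /= doubleK valK. Qed.

Lemma insub_od l : insub (od l)./2 = Some l.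
Proof. by rewrite /= uphalf_double valK. Qed.

Section Span.
Variables (L : 'I_s -> line k N) (l : 'I_s).
Hypothesis ML : line_mx L \in unitmx.

Lemma line_mx_span (x : 'rV[k]_N.+1) : x \in val (L l) <->
  exists2 w : 'rV_N.+1, (forall i, off l i -> w 0 i = 0) & x = w *m line_mx L.
Proof.
have [u [v [uv pE]]] := line_basis (L l).
have mulE (w : 'rV_N.+1) : (forall i, off l i -> w 0 i = 0) ->
    forall j, (w *m line_mx L) 0 j =
      w 0 (ev l) * (u 0 (ev l) * v 0 j - u 0 j * v 0 (ev l)) +
      w 0 (od l) * (u 0 (od l) * v 0 j - u 0 j * v 0 (od l)).
  move=> w0 j; rewrite mxE (sum_block hsN (l := l)) => [|i /w0 ->]; last by rewrite mul0r.
  by rewrite !mxE insub_ev insub_od !pE.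
pose bv (a b : k) : 'rV[k]_N.+1 :=
  \row_i (if i == ev l then a else if i == od l then b else 0).
have bv0 a b i : off l i -> bv a b 0 i = 0.
  move=> oi; rewrite mxE; case: eqP => [e|_]; first by move: oi; rewrite e off_ev.
  by case: eqP => [e|//]; move: oi; rewrite e off_od.
have bvE a b j : (bv a b *m line_mx L) 0 j =
      a * (u 0 (ev l) * v 0 j - u 0 j * v 0 (ev l)) +
      b * (u 0 (od l) * v 0 j - u 0 j * v 0 (od l)).
  by rewrite (mulE _ (bv0 a b)) !mxE eqxx (negbTE (od_ev _ _)) eqxx.
have bv_inj a b : bv a b *m line_mx L = 0 -> a = 0 /\ b = 0.
  move/(congr1 (mulmxr (invmx (line_mx L)))); rewrite /= mulmxK// mul0mx => /rowP e.
  have := e (ev l); have := e (od l).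
  by rewrite !mxE eqxx (negbTE (od_ev _ _)) eqxx.
split=> [/uv[a [b ->]]|[w w0 ->]]; last first.
  apply/uv; exists (- w 0 (ev l) * v 0 (ev l) - w 0 (od l) * v 0 (od l)).
  exists (w 0 (ev l) * u 0 (ev l) + w 0 (od l) * u 0 (od l)).
  by apply/rowP => j; rewrite mulE// !mxE; ring.
pose c := u 0 (ev l) * v 0 (od l) - u 0 (od l) * v 0 (ev l).
(* With [u], [v] spanning the line, row [i] is [u_i v - v_i u]. The combinations of rows [ev] and
   [od] with coefficients taken from [u] and from [v] are [c u] and [c v]. If [c] were 0,
   independence of the rows would kill these coefficients, hence both rows. *)
have c0 : c != 0.
  apply/eqP => c0.
  have [uo ue] : u 0 (od l) = 0 /\ - u 0 (ev l) = 0.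
    apply: bv_inj; apply/rowP => j; rewrite bvE mxE.
    by transitivity (c * u 0 j); [rewrite /c; ring|rewrite c0 mul0r].
  have [vo ve] : v 0 (od l) = 0 /\ - v 0 (ev l) = 0.
    apply: bv_inj; apply/rowP => j; rewrite bvE mxE.
    by transitivity (c * v 0 j); [rewrite /c; ring|rewrite c0 mul0r].
  have [] : (1 : k) = 0 /\ (0 : k) = 0.
    apply: bv_inj; apply/rowP => j; rewrite bvE mxE.
    by move/eqP: ue; move/eqP: ve; rewrite !oppr_eq0 => /eqP -> /eqP ->; ring.
  by move/eqP; rewrite oner_eq0.
(* The same two combinations, divided by [c], express [u] and [v] through the rows. *)
exists (bv ((a * u 0 (od l) + b * v 0 (od l)) / c)
           (- (a * u 0 (ev l) + b * v 0 (ev l)) / c)); first exact: bv0.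
apply/rowP => j; rewrite bvE !mxE.
by move: c0; rewrite /c => c0; field.
Qed.

End Span.

Let e_ (i : 'I_N.+1) : 'rV[k]_N.+1 := delta_mx 0 i.

Lemma coordinate_line_dim l : \dim <<[:: e_ (ev l); e_ (od l)]>>%VS == 2%N.
Proof.
suff fr : free [:: e_ (ev l); e_ (od l)] by rewrite (eqnP fr).
rewrite free_cons seq1_free span_seq1; apply/andP; split; last first.
  apply/eqP => /rowP/(_ (od l)); rewrite !mxE !eqxx /= => /eqP.
  by rewrite oner_eq0.
apply/negP => /vlineP[a] /rowP/(_ (ev l)); rewrite !mxE !eqxx /=.
by rewrite eq_sym (negbTE (od_ev _ _)) mulr0 => /eqP; rewrite oner_eq0.
Qed.

Definition coordinate_lines : 'I_s -> line k N :=
  fun l => exist (fun V => is_true (\dim V == 2%N)) _ (coordinate_line_dim l).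

Lemma coordinate_lines_det : \det (line_mx coordinate_lines) != 0.
Proof.
apply/det0P => -[w w0 wM]; case/negP: w0; apply/eqP/rowP => i; rewrite [RHS]mxE.
(* The matrix is monomial: each block is antisymmetric of size 2, so row [ev] is matched with column
   [od] and conversely, and each outer row with its own column. *)
suff [j [Mij Mj]] : exists j, line_mx coordinate_lines i j != 0 /\
    forall i', i' != i -> line_mx coordinate_lines i' j = 0.
  have /rowP/(_ j) := wM; rewrite !mxE (bigD1 i)//= big1 ?addr0 => [|i' /Mj ->].
    by move/eqP; rewrite mulf_eq0 (negbTE Mij) orbF => /eqP.
  by rewrite mulr0.
have supp l x : x \in val (coordinate_lines l) -> forall j, off l j -> x 0 j = 0.
  rewrite /= span_cons span_seq1 => /memv_addP[_ /vlineP[a ->] [_ /vlineP[b ->] ->]] j oj.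
  rewrite !mxE /=.
  have -> : j == ev l = false by apply/eqP => e; move: oj; rewrite e off_ev.
  have -> : j == od l = false by apply/eqP => e; move: oj; rewrite e off_od.
  by rewrite !mulr0 addr0.
have off0 l i' j : off l j -> plucker (coordinate_lines l) i' j = 0.
  move=> oj; have [u [v [uv ->]]] := line_basis (coordinate_lines l).
  have uV : u \in val (coordinate_lines l).
    by apply/uv; exists 1, 0; rewrite scale0r addr0 scale1r.
  have vV : v \in val (coordinate_lines l).
    by apply/uv; exists 0, 1; rewrite scale0r add0r scale1r.
  by rewrite (supp l u uV j oj) (supp l v vV j oj) mulr0 mul0r subr0.
have diag0 l j : plucker (coordinate_lines l) j j = 0 by rewrite /plucker subrr.
have swap l j j' : plucker (coordinate_lines l) j j' = - plucker (coordinate_lines l) j' j.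
  by rewrite /plucker opprB.
have minor l : plucker (coordinate_lines l) (ev l) (od l) != 0.
  have [u [v [uv ->]]] := line_basis (coordinate_lines l).
  have /uv[a [b ab]] : e_ (ev l) \in val (coordinate_lines l).
    by apply: memv_span; rewrite inE eqxx.
  have /uv[a' [b' ab']] : e_ (od l) \in val (coordinate_lines l).
    by apply: memv_span; rewrite !inE eqxx orbT.
  apply/eqP => c0.
  (* The basis chosen for the line is arbitrary: its minor times the determinant of the change to
     the standard basis is the standard minor 1. *)
  have : (a * b' - a' * b) *
      (u 0 (ev l) * v 0 (od l) - u 0 (od l) * v 0 (ev l)) = 1.
    transitivity (e_ (ev l) 0 (ev l) * e_ (od l) 0 (od l) -
        e_ (ev l) 0 (od l) * e_ (od l) 0 (ev l)).
      by rewrite ab ab' !mxE; ring.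
    by rewrite !mxE !eqxx /= (negbTE (od_ev _ _)) mul0r subr0 mulr1.
  by rewrite c0 mulr0 => /eqP; rewrite eq_sym oner_eq0.
have col0 l j : off l j = false -> forall i', off l i' \/ i' = j ->
    line_mx coordinate_lines i' j = 0.
  move=> oj i' h; rewrite mxE; case: insubP => [l' _ el'|is_].
    case: (eqVneq l' l) => [e|ll'].
      case: h => [oi|->]; last exact: diag0.
      by move: oi; rewrite /off -el' e eqxx.
    apply: off0; move/negbFE/eqP: oj => oj; rewrite /off oj.
    by rewrite eq_sym.
  case: eqP => // e; move: is_; rewrite e; move/negbFE/eqP: oj => ->.
  by rewrite ltn_ord.
have [is_|is_] := ltnP i./2 s; last first.
  have iN l : off l i by apply/eqP => e; move: is_; rewrite e leqNgt ltn_ord.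
  exists i; split; first by rewrite mxE insubF ?eqxx ?oner_eq0// ltnNge is_.
  move=> i' ii'; rewrite mxE; case: insubP => [l _ _|_]; first exact: off0.
  by rewrite (negbTE ii').
pose l : 'I_s := Ordinal is_.
have oi : off l i = false by rewrite /off eqxx.
have others j : i = ev l /\ j = od l \/ i = od l /\ j = ev l ->
    forall i', i' != i -> off l i' \/ i' = j.
  move=> h i' ii'; case E: (off l i'); [by left|right].
  by case: (off_false hsN E) ii'; case: h => -[-> ->] -> //; rewrite eqxx.
case: (off_false hsN oi) => ie.
  exists (od l); split; first by rewrite {1}ie mxE insub_ev minor.
  by move=> i' /(others (od l)) h; apply: (col0 l); [exact: off_od|apply: h; left].
exists (ev l); split; first by rewrite {1}ie mxE insub_od swap oppr_eq0 minor.
by move=> i' /(others (ev l)) h; apply: (col0 l); [exact: off_ev|apply: h; right].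
Qed.

Lemma general_lines_independent (Q : ('I_s -> line k N) -> Prop) :
  (forall L, line_mx L \in unitmx -> Q L) -> for_general_lines Q.
Proof.
move=> QU; exists [set L | \det (line_mx L) != 0]; split.
- exists [set \det line_mx_poly]; split=> [_ ->|]; first exact: multihomogeneous_det.
  apply/seteqP; split=> L /=.
    by move=> dn F ->; rewrite plucker_eval_det; apply: contrapT => /eqP.
  by move=> h; rewrite -plucker_eval_det (h (\det line_mx_poly))// eqxx.
- by exists coordinate_lines; exact: coordinate_lines_det.
by move=> L /= dL; apply: QU; rewrite unitmxE unitfE.
Qed.

End GeneralLines.

(** * Ideals of independent lines *)

(** The two candidates meet at [s = 2]; natural numerators and denominators allow the comparison of
    [m * q] with [p * r] in [nat]. *)
Lemma max_ratio (R : realType) (s : nat) : (1 <= s)%N ->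
  Num.max 1 (2 * ((s%:R - 1) / s%:R)) =
  (if s <= 2 then 1 else 2 * (s - 1))%N%:R / (if s <= 2 then 1 else s)%N%:R :> R.
Proof.
move=> hs; have s0 : 0 < s%:R :> R by rewrite ltr0n.
have e : (2 * (s - 1))%:R = 2 * (s%:R - 1) :> R by rewrite natrM natrB.
rewrite mulrA -e; case: leqP => s2.
  by rewrite divr1; apply/max_idPl; rewrite ler_pdivrMr// mul1r ler_nat; lia.
by apply/max_idPr; rewrite ler_pdivlMr// mul1r ler_nat; lia.
Qed.

Section IndependentLines.
Variables (k : closedFieldType) (N s : nat).
Hypotheses (hs : (1 <= s)%N) (hsN : (2 * s <= N + 1)%N).
Variable L : 'I_s -> line k N.
Hypothesis ML : line_mx L \in unitmx.
Local Notation M := (line_mx L).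
Local Notation I := (lines_ideal L).
Local Notation MI := (monomial_ideal k N.+1).
Local Notation monom u := (@mpolyX N.+1 k u).
Implicit Types (u : multinom N.+1).

Let sigmaK : cancel (lsubst M) (lsubst (invmx M)).
Proof. by apply: lsubstK; rewrite mulVmx. Qed.

Let tauK : cancel (lsubst (invmx M)) (lsubst M).
Proof. by apply: lsubstK; rewrite mulmxV. Qed.

Lemma independent_line_ideal l :
  line_ideal (L l) = lsubst M @^-1` MI (fun u => 1 <= wdeg (off l) u)%N.
Proof.
apply: (line_idealE hsN (mulmxV ML) (mulVmx ML)) => v.
exact: line_mx_span.
Qed.

Lemma independent_lines_ideal : I = lsubst M @^-1` MI (sym_exp s 1).
Proof.
apply/seteqP; split=> f.
  by move=> If u fu l; have := If l Logic.I; rewrite independent_line_ideal; apply.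
by move=> fM l _; rewrite independent_line_ideal => u /fM.
Qed.

Lemma independent_line_pow l m :
  ideal_pow (line_ideal (L l)) m = lsubst M @^-1` MI (fun u => m <= wdeg (off l) u)%N.
Proof.
by rewrite independent_line_ideal (pow_preim _ _ sigmaK tauK) wdeg_ideal_pow.
Qed.

Lemma independent_lines_pow r : ideal_pow I r = lsubst M @^-1` MI (pow_exp s r).
Proof.
rewrite independent_lines_ideal (pow_preim _ _ sigmaK tauK); congr (_ @^-1` _).
apply: monomial_ideal_pow.
- by move=> u; split=> [l|].
- move=> {}r u v [us uc]; split=> [l|]; rewrite wdegD; last by lia.
  by have := us l; lia.
- move=> {}r u v /(sym_exp1_pow hs)[us uc] [vs vc]; split=> [l|]; rewrite wdegD; last by lia.
  by have := us l; have := vs l; lia.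
by move=> {}r u; exact: pow_exp_split.
Qed.

Lemma independent_lines_symbolic m :
  symbolic_power I m = lsubst M @^-1` MI (sym_exp s m).
Proof.
(* A linear form that vanishes on every line except [L l]: the separating element for its prime. *)
pose x l := lsubst (invmx M) (monom (mnm1 (ev hsN l))).
rewrite (symbolic_power_bigcap (x := x)).
- apply/seteqP; split=> f.
    by move=> If u fu l; have := If l Logic.I; rewrite independent_line_pow; apply.
  by move=> fM l _; rewrite independent_line_pow => u /fM.
- by move=> l; rewrite independent_line_ideal; exact/prime_ideal_preim/wdeg_ideal_prime.
- move=> l; rewrite independent_line_ideal /= tauK => /monomial_ideal_monom.
  by rewrite wdeg1 off_ev.
- move=> l j jl; rewrite independent_line_ideal /= tauK; apply/monomial_ideal_monom.
  by rewrite wdeg1 /off /= doubleK lt0b eq_sym.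
move=> l f b; rewrite independent_line_pow independent_line_ideal /= rmorphM.
exact: wdeg_ideal_primary.
Qed.

(** Both ideals are monomial in the new coordinates, so a containment is tested on monomials. *)
Lemma noncontainmentP m r : ~ symbolic_power I m `<=` ideal_pow I r <->
  exists2 u : multinom N.+1, sym_exp s m u & ~ pow_exp s r u.
Proof.
rewrite independent_lines_symbolic independent_lines_pow; split.
  move=> nc; apply: contrapT => ex; apply: nc => f fm u fu.
  by apply: contrapT => nu; apply: ex; exists u => //; exact: fm.
move=> [u um nu] /(_ (lsubst (invmx M) (monom u))); rewrite /= tauK.
by move=> /(_ (proj2 (monomial_ideal_monom _ _ _) um))/monomial_ideal_monom.
Qed.

Lemma symbolic_degree m f : symbolic_power I m f -> f != 0 ->
  exists2 u : multinom N.+1, sym_exp s m u & (mdeg u <= (msize f).-1)%N.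
Proof.
rewrite independent_lines_symbolic => fm f0.
have : lsubst M f != 0.
  by apply: contra f0 => /eqP e; rewrite -[f]sigmaK e rmorph0.
rewrite -msupp_eq0; case E: (msupp (lsubst M f)) => [//|u t] _.
have uf : u \in msupp (lsubst M f) by rewrite E inE eqxx.
exists u; first exact: fm.
rewrite -ltnS (leq_trans (leq_trans (msize_mdeg_lt uf) (msize_lsubst M f)))//.
exact: leqSpred.
Qed.

Lemma symbolic_exists m u : sym_exp s m u -> exists f,
  [/\ symbolic_power I m f, f != 0 & ((msize f).-1 <= mdeg u)%N].
Proof.
move=> um; exists (lsubst (invmx M) (monom u)); split.
- by rewrite independent_lines_symbolic /= tauK; apply/monomial_ideal_monom.
- apply/eqP => /(congr1 (lsubst M)); rewrite tauK rmorph0 => /eqP.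
  by rewrite -msupp_eq0 msuppX.
have := msize_lsubst (invmx M) (monom u); rewrite msizeX.
by case: (msize (lsubst _ _)).
Qed.

Variable R : realType.

Let p := if (s <= 2)%N then 1%N else (2 * (s - 1))%N.
Let q := if (s <= 2)%N then 1%N else s.

Lemma noncontainment_lt m r : ~ symbolic_power I m `<=` ideal_pow I r ->
  (m * q < p * r)%N.
Proof.
move=> /noncontainmentP[u um nu]; rewrite /p /q.
case: (leqP s 2) => s2; case: (sym_exp_not_pow hs um nu) => [mr|[s2' h]] //=; first by lia.
  have e : s = 2%N by lia.
  by move: h; rewrite e; lia.
apply: (@leq_ltn_trans (2 * (s - 1) * m)).
  by rewrite mulnC leq_mul2r; apply/orP; right; lia.
by rewrite ltn_pmul2l//; lia.
Qed.

Lemma lt_noncontainment m r : (2 <= N)%N -> (m * q < p * r)%N ->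
  exists T, forall t, (T <= t)%N ->
  ~ symbolic_power I (m * t) `<=` ideal_pow I (r * t).
Proof.
move=> hN; rewrite /p /q; case: (leqP s 2) => s2 mr.
  exists 1%N => t t1; apply/noncontainmentP.
  have [u [um un]] := exists_sym_exp_ends hs (m * t) hN hsN.
  by exists u => //; apply: un; nia.
(* Rounding [m t / (s - 1)] up to the block exponent costs at most [s (s - 1)] once multiplied out,
   while the strict inequality scaled by [t] leaves a gap of [t]; thus [t >= s * s] suffices. *)
exists (s * s)%N => t ts; apply/noncontainmentP.
have [u [uw uc _]] := exists_sym_exp_blocks ((m * t) %/ (s - 1)).+1 hsN.
have := divn_eq (m * t) (s - 1); have := ltn_pmod (m * t) (_ : 0 < s - 1)%N.
move: (_ %/ _)%N (_ %% _)%N uw uc => b d uw uc /(_ ltac:(lia)) db e.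
exists u; first by move=> l; rewrite uw; nia.
move=> [_]; rewrite uc.
have h : (s * (m * t) + t <= 2 * (s - 1) * (r * t))%N by nia.
have h2 : ((s - 1) * (s * b.+1) < (s - 1) * (2 * (r * t)))%N by nia.
by rewrite leqNgt -(ltn_pmul2l (_ : 0 < s - 1)%N) ?h2//; lia.
Qed.

Lemma waldschmidt_free : (2 * s < N + 1)%N ->
  waldschmidt_seq R I x @[x --> \oo] --> (1 : R).
Proof.
move=> h; rewrite -[X in _ --> X]divr1; apply: (@waldschmidt_cvg R _ _ I 1 1 0) => //.
  move=> m f /symbolic_degree fm /fm[u /(sym_exp_mdeg hs) um].
  by rewrite !mul1n; exact: leq_trans.
move=> m; have [u um ud] := exists_sym_exp_free m h.
by have [f [? ? fu]] := symbolic_exists um; exists f; split=> //; rewrite addn0 !mul1n -ud.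
Qed.

Lemma waldschmidt_full : (2 <= N)%N -> (2 * s = N + 1)%N ->
  waldschmidt_seq R I x @[x --> \oo] --> ((N%:R + 1) / (N%:R - 1) : R).
Proof.
move=> hN h; have -> : (N%:R + 1) / (N%:R - 1) = s%:R / (s - 1)%:R :> R.
  have -> : N = (2 * (s - 1) + 1)%N by lia.
  have s0 : (s - 1)%:R != 0 :> R by rewrite pnatr_eq0; lia.
  have -> : s%:R = (s - 1)%:R + 1 :> R by rewrite natr1; congr (_%:R); lia.
  by rewrite natrD natrM; field; rewrite s0 /= addrK mulf_neq0// pnatr_eq0.
(* The error [s * (s - 1)] again comes from rounding [m] up to a multiple of [s - 1]. *)
apply: (@waldschmidt_cvg R _ _ I s (s - 1) (s * (s - 1))); first by lia.
  move=> m f /symbolic_degree fm /fm[u /(sym_exp_full h) um ud].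
  by rewrite (leq_trans um)// leq_mul2l ud orbT.
move=> m; have [u [uw _ ud]] := exists_sym_exp_blocks (m %/ (s - 1)).+1 hsN.
have := divn_eq m (s - 1); have := ltn_pmod m (_ : 0 < s - 1)%N.
move: (_ %/ _)%N (_ %% _)%N uw ud => b d uw ud /(_ ltac:(lia)) db e.
have um : sym_exp s m u by move=> l; rewrite uw; nia.
have [f [? ? fu]] := symbolic_exists um; exists f; split=> //.
by rewrite (leq_trans (leq_mul (leqnn _) fu))// ud; nia.
Qed.

End IndependentLines.

Theorem theorem1p5 (R : realType) (k : closedFieldType) (N s : nat)
    (hN : (2 <= N)%N) (hs : (1 <= s)%N) (hsN : (2 * s <= N + 1)%N) :
  for_general_lines (fun L : 'I_s -> line k N =>
    let I := lines_ideal L in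
    let c : R := Num.max 1 (2 * ((s%:R - 1) / s%:R)) in
    [/\ resurgence R I = c%:E,
        asymptotic_resurgence' R I = c%:E,
        asymptotic_resurgence R I = c%:E,
        cvgn (waldschmidt_seq R I)
      & ((2 * s < N + 1)%N -> waldschmidt R I = 1) /\
        ((2 * s = N + 1)%N -> waldschmidt R I = (N%:R + 1) / (N%:R - 1))]).
Proof.
apply: (general_lines_independent hsN) => L ML I c.
have p0 : (0 < if (s <= 2)%N then 1 else 2 * (s - 1))%N by case: (leqP s 2); lia.
have q0 : (0 < if (s <= 2)%N then 1 else s)%N by case: (leqP s 2); lia.
have lt := noncontainment_lt hs hsN ML.
have gt m r := @lt_noncontainment _ _ _ hs hsN _ ML m r hN.
rewrite /c max_ratio//; split.
- exact: resurgence_ratio p0 q0 _ _ lt gt.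
- exact: asymptotic_resurgence'_ratio p0 q0 _ _ lt gt.
- exact: asymptotic_resurgence_ratio p0 q0 _ _ lt gt.
- have [h|h] := ltnP (2 * s) (N + 1).
    by apply/cvg_ex; eexists; exact: (waldschmidt_free hs hsN ML h).
  have e : (2 * s = N + 1)%N by lia.
  by apply/cvg_ex; eexists; exact: (waldschmidt_full hs hsN ML hN e).
split=> h; apply: cvg_lim => //; first exact: waldschmidt_free.
exact: waldschmidt_full.
Qed.
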